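(* Let $G$ be a finite connected simple graph with at least one edge and $\kappa_{\min}(G)>0$. Put $n:=|V(G)|$, $\Delta:=\max_{v\in V(G)}d_v$ and $R:=\lfloor 2/\kappa_{\min}(G)\rfloor$. Then, for every base vertex $o\in V(G)$, the quotient group \[ \pi_1^{\mathrm{GLMY}}(G,o)/N_5(G,o) \] is finite and satisfies \[ \bigl|\pi_1^{\mathrm{GLMY}}(G,o)/N_5(G,o)\bigr|\le\frac{1+\Delta\sum_{j=0}^{R-1}(\Delta-1)^j}{n}, \] where $(\Delta-1)^0$ is interpreted as $1$, also when $\Delta=1$.
   Context: Graphs are undirected and simple; $x\sim y$ denotes adjacency, $d$ is the graph distance, $d_x$ is the degree of $x$. **Lin--Lu--Yau curvature.** Let $G=(V,E)$ be a connected locally finite graph. For a vertex $x$ of positive degree and $\alpha\in[0,1]$ let $\mu_x^\alpha$ be the probability measure on $V$ with $\mu_x^\alpha(x)=\alpha$, $\mu_x^\alpha(z)=(1-\alpha)/d_x$ for $z\sim x$, and $\mu_x^\alpha(z)=0$ otherwise. For finitely supported probability measures $\mu,\nu$ on $V$, $W_1(\mu,\nu)=\inf_\pi\sum_{u,v}d(u,v)\pi(u,v)$, the infimum being over all couplings $\pi:V\times V\to[0,\infty)$ of $\mu$ and $\nu$. For distinct $x,y$ put $\kappa_\alpha(x,y)=1-W_1(\mu_x^\alpha,\mu_y^\alpha)/d(x,y)$ and $\kappa(x,y)=\lim_{\alpha\to1^-}\kappa_\alpha(x,y)/(1-\alpha)$ (the limit is known to exist). For a finite graph with at least one edge, $\kappa_{\min}(G)=\min_{\{x,y\}\in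 E(G)}\kappa(x,y)$. **GLMY fundamental group.** For a connected graph $G$ with base vertex $o$, $\pi_1^{\mathrm{GLMY}}(G,o)$ is the group (under concatenation) of equivalence classes of edge paths (finite vertex sequences whose consecutive vertices are equal or adjacent) starting and ending at $o$, under the equivalence relation generated by the local replacements: $\ldots aa\ldots\leftrightarrow\ldots a\ldots$; $\ldots aba\ldots\leftrightarrow\ldots a\ldots$ for $a\sim b$; $\ldots abc\ldots\leftrightarrow\ldots ac\ldots$ when $a,b,c$ form a $3$-cycle; and $\ldots abc\ldots\leftrightarrow\ldots adc\ldots$ and $\ldots abcd\ldots\leftrightarrow\ldots ad\ldots$ when $(a,b,c,d)$ is a simple $4$-cycle. It is known to be naturally isomorphic to the ordinary fundamental group $\pi_1(X_{\le4}(G),o)$ of the CW complex obtained from $G$ by attaching one $2$-cell along each simple cycle of length $3$ or $4$. **The subgroup $N_5(G,o)$.** Fix a spanning tree $T$ of $G$. For each simple $5$-cycle $C$ choose a vertex of $C$ and a cyclic orientation of $C$; the associated based loop follows the path in $T$ from $o$ to that vertex, traverses $C$ once in the chosen orientation, and returns along the inverse tree path. $N_5(G,o)\triangleleft\pi_1^{\mathrm{GLMY}}(G,o)$ is the normal closure of all these based $5$-cycle loops (it does not depend on the choices). *)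

(* Defs.v *)
From HB Require Import structures.
From Stdlib Require Import Relations.
From mathcomp Require Import all_boot all_order all_algebra.
From mathcomp Require Import generic_quotient.
From mathcomp Require Import all_classical all_reals all_analysis.

Set Implicit Arguments.
Unset Strict Implicit.
Unset Printing Implicit Defensive.

Import Order.TTheory GRing.Theory Num.Theory numFieldNormedType.Exports.

Local Open Scope quotient_scope.

Record sgraph := SGraph {
  vertex :> finType;
  adj : rel vertex;
  adj_sym : symmetric adj;
  adj_irrefl : irreflexive adj
}.

Section Graph.
Variable G : sgraph.

Definition is_connected := forall x y : G, connect (@adj G) x y.

Definition deg (x : G) : nat := #|[pred y | adj x y]|.

Definition max_deg : nat := \max_(x : G) deg x.

Definition has_walk (x y : G) (n : nat) : bool :=
  [exists p : n.-tuple G, path (@adj G) x p && (last x p == y)].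

(* The value 0 is junk when no walk joins the two vertices; this never happens
   in a connected graph. *)
Definition dist (x y : G) : nat :=
  if pselect (exists n, has_walk x y n) is left h then ex_minn h else 0.

(* A simple k-cycle is given by a duplicate-free sequence c of k >= 3 vertices
   with [ucycle adj c]. *)

(* The subgraph traced by a cyclic sequence: it forgets the starting vertex and
   the orientation. *)
Definition cycle_edges (c : seq G) : {set {set G}} :=
  [set [set x; next c x] | x in c]%SET.

Definition spanning_tree (t : rel G) : Prop :=
  [/\ symmetric t, subrel t (@adj G),
      forall x y, connect t x y
    & forall c, ucycle t c -> size c <= 2].

(* A choice of one vertex and one orientation for each simple 5-cycle: each
   5-cycle subgraph is traced by exactly one sequence of S. *)
Definition marked_5cycles (S : {set 5.-tuple G}) : Prop :=
  (forall s, s \in S -> ucycle (@adj G) s) /\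
  (forall c : 5.-tuple G, ucycle (@adj G) c ->
     exists! s, s \in S /\ cycle_edges s = cycle_edges c).

End Graph.

Section Curvature.
Variables (R : realType) (G : sgraph).
Local Open Scope ring_scope.
Local Open Scope classical_set_scope.
Implicit Types (x y : G) (mu nu : G -> R).

Definition lazy_walk (a : R) x : G -> R := fun z =>
  if z == x then a else if adj x z then (1 - a) / (deg x)%:R else 0.

Definition coupling mu nu (p : G -> G -> R) : Prop :=
  [/\ forall u v, 0 <= p u v,
      forall u, \sum_v p u v = mu u
    & forall v, \sum_u p u v = nu v].

Definition W1 mu nu : R :=
  inf [set \sum_u \sum_v (dist u v)%:R * p u v | p in coupling mu nu].

Definition kappa_lazy (a : R) x y : R :=
  1 - W1 (lazy_walk a x) (lazy_walk a y) / (dist x y)%:R.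

Definition kappa x y : R :=
  lim ((fun a : R => kappa_lazy a x y / (1 - a)) @ (1 : R)^'-).

(* The junk value 0 is taken only when G has no edge. *)
Definition kappa_min : R :=
  if [pick p : G * G | adj p.1 p.2] is Some p0 then
    \big[Num.min/kappa p0.1 p0.2]_(p : G * G | adj p.1 p.2) kappa p.1 p.2
  else 0.

End Curvature.

Section Quotient.
Local Open Scope group_scope.
Local Open Scope classical_set_scope.
Variable gT : groupType.

Definition is_normal_subgroup (N : set gT) : Prop :=
  [/\ N 1,
      forall x y, N x -> N y -> N (x * y),
      forall x, N x -> N x^-1
    & forall x y, N x -> N (x ^ y)].

Record normal_subgroup := NormalSubgroup {
  nsub_set : set gT;
  nsubP : is_normal_subgroup nsub_set
}.

Lemma normal_closure_subproof (A : set gT) : is_normal_subgroup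
  (\bigcap_(N in [set N | is_normal_subgroup N /\ A `<=` N]) N).
Proof.
split=> [N [[]]//|x y xN yN N NP|x xN N NP|x y xN N NP];
  have [[N1 NM NV NJ] _] := NP.
- by apply: NM; [apply: xN|apply: yN].
- by apply: NV; apply: xN.
- by apply: NJ; apply: xN.
Qed.

Definition normal_closure (A : set gT) : normal_subgroup :=
  NormalSubgroup (normal_closure_subproof A).

Variable N : normal_subgroup.

Definition coset_rel (x y : gT) : bool := `[< nsub_set N (x^-1 * y) >].

Lemma coset_rel_refl : reflexive coset_rel.
Proof. by move=> x; apply/asboolP; rewrite mulVg; case: (nsubP N). Qed.

Lemma coset_rel_sym : symmetric coset_rel.
Proof.
have sub x y : coset_rel x y -> coset_rel y x.
  move=> /asboolP xy; apply/asboolP.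
  by have [_ _ NV _] := nsubP N; have := NV _ xy; rewrite invgM invgK.
by move=> x y; apply/idP/idP; apply: sub.
Qed.

Lemma coset_rel_trans : transitive coset_rel.
Proof.
move=> y x z /asboolP xy /asboolP yz; apply/asboolP.
have [_ NM _ _] := nsubP N; have := NM _ _ xy yz.
by rewrite mulgA mulgK.
Qed.

Canonical coset_equiv :=
  EquivRel coset_rel coset_rel_refl coset_rel_sym coset_rel_trans.

Definition quotient_group : Type := {eq_quot coset_rel}.

HB.instance Definition _ := Choice.on quotient_group.

Definition quot_pi (x : gT) : quotient_group := \pi_({eq_quot coset_rel}) x.
Definition quot_repr (x : quotient_group) : gT :=
  repr (x : {eq_quot coset_rel}).
Definition quot_one : quotient_group := quot_pi 1.
Definition quot_mul (x y : quotient_group) : quotient_group :=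
  quot_pi (quot_repr x * quot_repr y).
Definition quot_inv (x : quotient_group) : quotient_group :=
  quot_pi (quot_repr x)^-1.

Lemma quot_reprK x : quot_pi (quot_repr x) = x.
Proof. exact: reprK. Qed.

Lemma quot_piP x y : quot_pi x = quot_pi y <-> nsub_set N (x^-1 * y).
Proof.
split=> [/eqmodP/asboolP//|xy].
by apply/eqmodP/asboolP.
Qed.

Lemma quot_piM x y : quot_mul (quot_pi x) (quot_pi y) = quot_pi (x * y).
Proof.
have [N1 NM NV NJ] := nsubP N.
have /quot_piP := quot_reprK (quot_pi x); set x' := quot_repr _ => xx'.
have /quot_piP := quot_reprK (quot_pi y).
rewrite /quot_mul -/x'; set y' := quot_repr _ => yy'.
apply/quot_piP.
have -> : (x' * y')^-1 * (x * y) = (x'^-1 * x) ^ y' * (y'^-1 * y).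
  by rewrite /conjg invgM !mulgA mulgK.
by apply: NM => //; apply: NJ.
Qed.

Lemma quot_mulA : associative quot_mul.
Proof.
move=> x y z; rewrite -(quot_reprK x) -(quot_reprK y) -(quot_reprK z).
by rewrite !quot_piM mulgA.
Qed.

Lemma quot_mul1 : left_id quot_one quot_mul.
Proof. by move=> x; rewrite -(quot_reprK x) quot_piM mul1g. Qed.

Lemma quot_1mul : right_id quot_one quot_mul.
Proof. by move=> x; rewrite -(quot_reprK x) quot_piM mulg1. Qed.

Lemma quot_mulV : left_inverse quot_one quot_inv quot_mul.
Proof. by move=> x; rewrite -{2}(quot_reprK x) quot_piM mulVg. Qed.

Lemma quot_Vmul : right_inverse quot_one quot_inv quot_mul.
Proof. by move=> x; rewrite -{1}(quot_reprK x) quot_piM mulgV. Qed.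

HB.instance Definition _ := isGroup.Build quotient_group
  quot_mulA quot_mul1 quot_1mul quot_mulV quot_Vmul.

End Quotient.

Section GLMY.
Variable G : sgraph.
Implicit Types (a b c d : G).

(* Edge paths may be stationary. *)
Definition eq_adj : rel G := fun a b => (a == b) || adj a b.

Inductive local_move : seq G -> seq G -> Prop :=
| LM_stay a : local_move [:: a; a] [:: a]
| LM_back a b : adj a b -> local_move [:: a; b; a] [:: a]
| LM_tri a b c : ucycle (@adj G) [:: a; b; c] ->
    local_move [:: a; b; c] [:: a; c]
| LM_square a b c d : ucycle (@adj G) [:: a; b; c; d] ->
    local_move [:: a; b; c] [:: a; d; c]
| LM_square3 a b c d : ucycle (@adj G) [:: a; b; c; d] ->
    local_move [:: a; b; c; d] [:: a; d].

Definition glmy_step (w w' : seq G) : Prop :=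
  exists u v s s', [/\ local_move s s', w = u ++ s ++ v & w' = u ++ s' ++ v].

Variable o : G.

(* As in path.v, the vertex sequence of a loop is o :: p: the sequence p omits
   the initial o, but includes the final one (unless p is empty). *)
Record loop := Loop {
  loop_tail :> seq G;
  loopP : path eq_adj o loop_tail && (last o loop_tail == o)
}.

HB.instance Definition _ := [isSub for loop_tail].
HB.instance Definition _ := [Choice of loop by <:].

Definition loop_equiv : relation loop :=
  clos_refl_sym_trans loop (fun p q => glmy_step (o :: p) (o :: q)).

Definition loop_rel (p q : loop) : bool := `[< loop_equiv p q >].

Lemma loop_rel_refl : reflexive loop_rel.
Proof. by move=> p; apply/asboolP; apply: rst_refl. Qed.

Lemma loop_rel_sym : symmetric loop_rel.
Proof. by move=> p q; apply/asboolP/asboolP; apply: rst_sym. Qed.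

Lemma loop_rel_trans : transitive loop_rel.
Proof.
by move=> q p r /asboolP pq /asboolP qr; apply/asboolP; apply: rst_trans qr.
Qed.

Canonical loop_equivRel :=
  EquivRel loop_rel loop_rel_refl loop_rel_sym loop_rel_trans.

Lemma loop_cat_subproof (p q : loop) :
  path eq_adj o (p ++ q) && (last o (p ++ q) == o).
Proof.
case: p q => p /andP[pp /eqP pl] [q /andP[qp ql]] /=.
by rewrite cat_path last_cat pl pp qp ql.
Qed.

Definition loop_nil : loop := @Loop [::] (eqxx o).
Definition loop_cat (p q : loop) : loop := Loop (loop_cat_subproof p q).

Lemma eq_adj_sym : symmetric eq_adj.
Proof. by move=> a b; rewrite /eq_adj eq_sym adj_sym. Qed.

Lemma path_rev_belast a p :
  path eq_adj (last a p) (rev (belast a p)) = path eq_adj a p.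
Proof.
rewrite rev_path; apply: eq_path => x y; exact: eq_adj_sym.
Qed.

Lemma last_rev_belast a (p : seq G) : last (last a p) (rev (belast a p)) = a.
Proof. by case: p => //= b p; rewrite rev_cons last_rcons. Qed.

Lemma loop_rev_subproof (p : loop) :
  path eq_adj o (rev (belast o p)) && (last o (rev (belast o p)) == o).
Proof.
case: p => p /= /andP[pp /eqP pl].
have := path_rev_belast o p; have := last_rev_belast o p.
by rewrite pl => -> ->; rewrite pp eqxx.
Qed.

Definition loop_rev (p : loop) : loop := Loop (loop_rev_subproof p).

Lemma loop_equiv_cat (p p' q q' : loop) : loop_equiv p p' ->
  loop_equiv q q' -> loop_equiv (loop_cat p q) (loop_cat p' q').
Proof.
move=> pp' qq'; apply: (@rst_trans _ _ _ (loop_cat p' q)).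
  elim: pp' => {p p'} [p p' [u [v [s [s' [ss' pE p'E]]]]]|p|p p' _|].
  - apply: rst_step; exists u, (v ++ q), s, s'; split=> //=.
      by rewrite -cat_cons pE -!catA.
    by rewrite -cat_cons p'E -!catA.
  - exact: rst_refl.
  - exact: rst_sym.
  - by move=> p1 p2 p3 _ + _; apply: rst_trans.
have oE r : o :: p' ++ r = belast o p' ++ o :: r.
  rewrite -cat_cons lastI cat_rcons.
  by case: (p') => /= l /andP[_ /eqP ->].
elim: qq' => {q q'} [q q' [u [v [s [s' [ss' qE q'E]]]]]|q|q q' _|].
- apply: rst_step; exists (belast o p' ++ u), v, s, s'; split=> //=.
    by rewrite oE qE -!catA.
  by rewrite oE q'E -!catA.
- exact: rst_refl.
- exact: rst_sym.
- by move=> q1 q2 q3 _ + _; apply: rst_trans.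
Qed.

Lemma palindrome_equiv (p : seq G) (l : loop) : path eq_adj o p ->
  loop_tail l = p ++ rev (belast o p) -> loop_equiv l loop_nil.
Proof.
elim/last_ind: p l => [|p a IHp] l.
  move=> _ lE; have -> : l = loop_nil by apply: val_inj.
  exact: rst_refl.
rewrite rcons_path => /andP[pp la] lE.
have Lp : path eq_adj o (p ++ rev (belast o p)) &&
          (last o (p ++ rev (belast o p)) == o).
  by rewrite cat_path last_cat pp path_rev_belast pp last_rev_belast eqxx.
apply: rst_trans (IHp (Loop Lp) pp erefl).
have pE : o :: p ++ rev (belast o p) =
    belast o p ++ [:: last o p] ++ rev (belast o p).
  by rewrite -cat_cons lastI cat_rcons.
have lE' : o :: l =
    belast o p ++ [:: last o p; a; last o p] ++ rev (belast o p).
  have rE : rev (o :: p) = last o p :: rev (belast o p).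
    by rewrite lastI rev_rcons.
  by rewrite lE belast_rcons rE cat_rcons -cat_cons lastI cat_rcons.
case/orP: la => [/eqP laE|la]; last first.
  apply: rst_step; exists (belast o p), (rev (belast o p)).
  exists [:: last o p; a; last o p], [:: last o p]; split=> //.
  exact: LM_back.
have Lm : path eq_adj o (p ++ last o p :: rev (belast o p)) &&
          (last o (p ++ last o p :: rev (belast o p)) == o).
  rewrite cat_path last_cat /= pp path_rev_belast pp last_rev_belast eqxx.
  by rewrite /eq_adj eqxx.
have mE : o :: p ++ last o p :: rev (belast o p) =
    belast o p ++ [:: last o p; last o p] ++ rev (belast o p).
  by rewrite -cat_cons lastI cat_rcons.
apply: (@rst_trans _ _ _ (Loop Lm)); apply: rst_step.
  exists (belast o p), (last o p :: rev (belast o p)).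
  exists [:: last o p; last o p], [:: last o p]; split.
  - exact: LM_stay.
  - by rewrite lE' -laE.
  - by rewrite /= mE.
exists (belast o p), (rev (belast o p)).
exists [:: last o p; last o p], [:: last o p]; split=> //.
exact: LM_stay.
Qed.

Lemma loop_cat_rev (p : loop) : loop_equiv (loop_cat p (loop_rev p)) loop_nil.
Proof.
by apply: (@palindrome_equiv p) => //; case: p => p /= /andP[].
Qed.

Lemma loop_rev_cat (p : loop) : loop_equiv (loop_cat (loop_rev p) p) loop_nil.
Proof.
have -> : loop_cat (loop_rev p) p =
          loop_cat (loop_rev p) (loop_rev (loop_rev p)).
  apply: val_inj => /=; congr (_ ++ _).
  case: p => p /= /andP[_ /eqP pl].
  have oE : o :: rev (belast o p) = rev (o :: p).
    by rewrite [in RHS]lastI rev_rcons pl.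
  apply: (can_inj revK); rewrite revK; apply: (@rcons_injl _ o).
  have rl := last_rev_belast o p; rewrite pl in rl.
  by rewrite -rev_cons -oE lastI rl.
exact: loop_cat_rev.
Qed.

Definition glmy_pi1 : Type := {eq_quot loop_rel}.

HB.instance Definition _ := Choice.on glmy_pi1.

Definition loop_class (p : loop) : glmy_pi1 := \pi_({eq_quot loop_rel}) p.
Definition pi1_repr (x : glmy_pi1) : loop := repr (x : {eq_quot loop_rel}).
Definition pi1_one : glmy_pi1 := loop_class loop_nil.
Definition pi1_mul (x y : glmy_pi1) : glmy_pi1 :=
  loop_class (loop_cat (pi1_repr x) (pi1_repr y)).
Definition pi1_inv (x : glmy_pi1) : glmy_pi1 :=
  loop_class (loop_rev (pi1_repr x)).

Lemma pi1_reprK x : loop_class (pi1_repr x) = x.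
Proof. exact: reprK. Qed.

Lemma loop_classP p q : loop_class p = loop_class q <-> loop_equiv p q.
Proof.
split=> [/eqmodP/asboolP//|pq].
by apply/eqmodP/asboolP.
Qed.

Lemma loop_classM p q :
  pi1_mul (loop_class p) (loop_class q) = loop_class (loop_cat p q).
Proof.
by apply/loop_classP; apply: loop_equiv_cat; apply/loop_classP; apply: pi1_reprK.
Qed.

Lemma pi1_mulA : associative pi1_mul.
Proof.
move=> x y z; rewrite -(pi1_reprK x) -(pi1_reprK y) -(pi1_reprK z).
rewrite !loop_classM; congr loop_class; apply: val_inj => /=.
exact: catA.
Qed.

Lemma pi1_mul1 : left_id pi1_one pi1_mul.
Proof.
move=> x; rewrite -(pi1_reprK x) loop_classM; congr loop_class.
exact: val_inj.
Qed.

Lemma pi1_1mul : right_id pi1_one pi1_mul.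
Proof.
move=> x; rewrite -(pi1_reprK x) loop_classM; congr loop_class.
by apply: val_inj; rewrite /= cats0.
Qed.

Lemma pi1_mulV : left_inverse pi1_one pi1_inv pi1_mul.
Proof.
move=> x; rewrite -{2}(pi1_reprK x) loop_classM.
by apply/loop_classP; apply: loop_rev_cat.
Qed.

Lemma pi1_Vmul : right_inverse pi1_one pi1_inv pi1_mul.
Proof.
move=> x; rewrite -{1}(pi1_reprK x) loop_classM.
by apply/loop_classP; apply: loop_cat_rev.
Qed.

HB.instance Definition _ := isGroup.Build glmy_pi1
  pi1_mulA pi1_mul1 pi1_1mul pi1_mulV pi1_Vmul.

(* The loop with vertices o :: p ++ rcons c x ++ rev (belast o p) goes from o to
   x = last o p along p, runs once around the cycle x :: c, and returns along
   p.  In a tree t there is exactly one duplicate-free path p from o to x. *)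
Definition is_5cycle_loop (t : rel G) (S : {set 5.-tuple G}) (l : loop) : Prop :=
  exists (s : 5.-tuple G) (p : seq G) (x : G) (c : seq G),
    [/\ s \in S, tval s = x :: c, path t o p && uniq (o :: p), last o p = x
      & loop_tail l = p ++ rcons c x ++ rev (belast o p)].

Definition N5 (t : rel G) (S : {set 5.-tuple G}) : normal_subgroup glmy_pi1 :=
  normal_closure [set loop_class l | l in is_5cycle_loop t S]%classic.

End GLMY.

(* Main.v *)
Require Import Defs.
From Stdlib Require Import Relations.
From mathcomp Require Import all_boot all_order all_algebra.
From mathcomp Require Import finmap.
From mathcomp Require Import ring lra zify.
From mathcomp Require Import all_classical all_reals all_analysis.

Set Implicit Arguments.
Unset Strict Implicit.
Unset Printing Implicit Defensive.

Import Order.TTheory GRing.Theory Num.Theory numFieldNormedType.Exports.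

(** The quotient of the fundamental group is bounded by a Bonnet-Myers argument
    on a covering graph.

    Write Q for the quotient group. Choosing a path from the base vertex to
    every vertex turns each oriented edge xy into a loop, hence into an element
    phi x y of Q, and the walks of G lift to walks in the graph on Q * G in
    which (g, x) is joined to (g * phi x y, y). This is the cover of G that
    corresponds to the kernel of the quotient map; it has |Q| n vertices. The
    element of Q multiplied along a walk is called its voltage. A simple cycle
    of length at most 5 has trivial voltage (flatness): for lengths 3 and 4 by
    the local moves, for length 5 because of N5. So every closed walk of length
    at most 5 lifts to a closed walk ([flat_closed_walk]).

    Curvature of an edge xy is decided by the distances between neighbours of x
    and neighbours of y. A distance of at most 2 closes up, through x and y, to
    a closed walk of length at most 5, and a distance of 3 is realised by the
    path through x and y. Hence lifting does not increase these distances
    ([height_lipschitz]), and the cover is at least as curved as G.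

    No transport on the cover itself is needed for the diameter bound. Let
    the height be the distance to the base vertex of the cover. If height
    increases by 1 along an edge, then testing an arbitrary coupling of the two
    lazy walks against the height function shows that its Laplacian decreases
    by at least the curvature along that edge ([laplacian_drop]). Along a
    geodesic of length L the Laplacian thus loses at least L kappa_min; it lies
    between -1 and 1, so L <= 2 / kappa_min ([height_le]).

    Finally, geodesics from the base vertex never backtrack, so there are at
    most as many vertices of height at most r as there are non-backtracking
    walks of length at most r in G ([cover_card]). *)

(** * Curvature and the Laplacian of a function *)

Section Transport.
Variables (R : realType) (G : sgraph).
Implicit Types (x y u v : G) (f g h : G -> R) (a : R).
Local Open Scope ring_scope.

Definition laplacian f x : R := (\sum_(u | adj x u) (f u - f x)) / (deg x)%:R.

Lemma deg_gt0 x y : adj x y -> (0 < deg x)%N.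
Proof. by move=> xy; apply/card_gt0P; exists y. Qed.

Lemma lazy_walk_eq0 a x u : ~~ eq_adj x u -> lazy_walk a x u = 0.
Proof.
by rewrite /eq_adj negb_or eq_sym /lazy_walk => /andP[/negPf-> /negPf->].
Qed.

Lemma lazy_walk_ge0 a x u : 0 <= a <= 1 -> 0 <= lazy_walk a x u.
Proof.
move=> /andP[a0 a1]; rewrite /lazy_walk; do 2?case: ifP => // _.
by rewrite divr_ge0// subr_ge0.
Qed.

Lemma lazy_walk_mean a x f : (0 < deg x)%N ->
  \sum_u f u * lazy_walk a x u = f x + (1 - a) * laplacian f x.
Proof.
move=> x0; rewrite (bigD1 x)//= {1}/lazy_walk eqxx.
have -> : \sum_(u | u != x) f u * lazy_walk a x u =
          (1 - a) / (deg x)%:R * \sum_(u | adj x u) f u.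
  rewrite mulr_sumr big_mkcond [RHS]big_mkcond /=; apply: eq_bigr => u _.
  rewrite /lazy_walk; case: eqP => [->|_] /=; first by rewrite adj_irrefl.
  by case: ifP => _; rewrite ?mulr0// mulrC.
rewrite /laplacian sumrB sumr_const -[X in _ *+ X]/(deg x) -mulr_natl.
by field; rewrite pnatr_eq0 -lt0n.
Qed.

Lemma lazy_walk_sum1 a x : (0 < deg x)%N -> \sum_u lazy_walk a x u = 1.
Proof.
have lap0 : laplacian (fun=> 1) x = 0.
  by rewrite /laplacian big1 ?mul0r// => u _; rewrite subrr.
move=> x0; have := lazy_walk_mean a (fun=> 1) x0.
by rewrite lap0 mulr0 addr0 => <-; apply: eq_bigr => u _; rewrite mul1r.
Qed.

(** The easy half of Kantorovich duality. The two sides of the transport are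
    tested against two functions g and h that need not agree: they will be the
    height function read in the lifts of the two unit balls, and a vertex lying
    in both balls may have different lifts a priori. Since a coupling is
    supported on the product of the balls, only these balls matter. *)
Lemma W1_ge a x y g h : 0 <= a <= 1 -> adj x y ->
  (forall u v, eq_adj x u -> eq_adj y v -> h v - g u <= (dist u v)%:R) ->
  \sum_v h v * lazy_walk a y v - \sum_u g u * lazy_walk a x u <=
    W1 (lazy_walk a x) (lazy_walk a y).
Proof.
move=> a01 xy hg; have dx := deg_gt0 xy; have yx := xy.
rewrite adj_sym in yx; have dy := deg_gt0 yx.
apply: lb_le_inf.
  eexists; exists (fun u v => lazy_walk a x u * lazy_walk a y v) => //.
  split=> [u v|u|v]; first by rewrite mulr_ge0// lazy_walk_ge0.
    by rewrite -mulr_sumr lazy_walk_sum1// mulr1.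
  by rewrite -mulr_suml lazy_walk_sum1// mul1r.
move=> _ [p [p0 px py] <-].
have -> : \sum_u g u * lazy_walk a x u = \sum_u \sum_v g u * p u v.
  by apply: eq_bigr => u _; rewrite -px mulr_sumr.
have -> : \sum_v h v * lazy_walk a y v = \sum_u \sum_v h v * p u v.
  by rewrite exchange_big; apply: eq_bigr => v _; rewrite -py mulr_sumr.
rewrite -sumrB; apply: ler_sum => u _; rewrite -sumrB; apply: ler_sum => v _.
rewrite -mulrBl.
have [xu|/(lazy_walk_eq0 a) xu] := boolP (eq_adj x u); last first.
  have : \sum_v p u v == 0 by rewrite px xu.
  rewrite psumr_eq0// => /allP/(_ v (mem_index_enum _))/eqP ->.
  by rewrite !mulr0.
have [yv|/(lazy_walk_eq0 a) yv] := boolP (eq_adj y v); last first.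
  have : \sum_u p u v == 0 by rewrite py yv.
  rewrite psumr_eq0// => /allP/(_ u (mem_index_enum _))/eqP ->.
  by rewrite !mulr0.
by apply: ler_wpM2r; [exact: p0|exact: hg].
Qed.

Lemma has_walkP x y n :
  reflect (exists p, [/\ path (@adj G) x p, last x p = y & size p = n])
          (has_walk x y n).
Proof.
apply: (iffP existsP) => [[p /andP[pp /eqP pl]]|[p [pp pl ps]]].
  by exists p; rewrite size_tuple.
by move/eqP: ps => ps; exists (Tuple ps); rewrite /= pp pl eqxx.
Qed.

Lemma dist_walk x y : is_connected G ->
  exists p, [/\ path (@adj G) x p, last x p = y & size p = dist x y].
Proof.
move=> G_conn; apply/has_walkP; rewrite /dist; case: pselect => [h|[]].
  by case: ex_minnP.
have /connectP[p pp ->] := G_conn x y.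
by exists (size p); apply/has_walkP; exists p.
Qed.

Lemma dist_adj x y : is_connected G -> adj x y -> dist x y = 1%N.
Proof.
move=> G_conn xy; apply/eqP; rewrite eqn_leq; apply/andP; split.
  rewrite /dist; case: pselect => // h; case: ex_minnP => m _; apply.
  by apply/has_walkP; exists [:: y]; rewrite /= xy.
have [[|z p] [_ /= pl <-//]] := dist_walk x y G_conn.
by move: xy; rewrite -pl adj_irrefl.
Qed.

(** For laziness a, [W1_ge] bounds the transport cost below by
    1 + (1 - a) D, where D is the change of the Laplacian; so the quotient that
    defines the curvature is at most -D for every a, and so is its limit. *)
Lemma laplacian_drop x y g h : is_connected G -> adj x y -> 0 < kappa R x y ->
  (forall u v, eq_adj x u -> eq_adj y v -> h v - g u <= (dist u v)%:R) ->
  h y - g x = 1 -> laplacian h y - laplacian g x <= - kappa R x y.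
Proof.
move=> G_conn xy k0 hg hg1; have yx := xy; rewrite adj_sym in yx.
rewrite lerNr; apply: limr_le.
  (* A divergent limit takes the default value 0, against [0 < kappa]. *)
  by apply: contrapT => /dvgP k; move: k0; rewrite /kappa k ltxx.
near=> a.
have a0 : 0 < a by near: a; apply: nbhs_left_gt.
have a1 : a < 1 by near: a; apply: nbhs_left_lt.
have a01 : 0 <= a <= 1 by rewrite !ltW.
have := W1_ge a01 xy hg.
rewrite !lazy_walk_mean ?(deg_gt0 xy)// ?(deg_gt0 yx)//.
rewrite /kappa_lazy dist_adj// divr1 ler_pdivrMr ?subr_gt0//.
by move=> W; lra.
Unshelve. all: by end_near.
Qed.

Lemma kappa_min_le x y : adj x y -> kappa_min R G <= kappa R x y.
Proof.
move=> xy; rewrite /kappa_min; case: pickP => [p _|/(_ (x, y))]; last first.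
  by rewrite /= xy.
exact: (bigmin_le_cond _ _ (j := (x, y))).
Qed.

End Transport.

(** * Voltages and short closed walks *)

Section Voltage.
Variables (G : sgraph) (Q : groupType) (phi : G -> G -> Q).
Implicit Types (x y u v w : G) (p c : seq G) (g h : Q).
Local Open Scope group_scope.

Fixpoint voltage x p : Q := if p is y :: p' then phi x y * voltage y p' else 1.

Lemma voltage_cat x p1 p2 :
  voltage x (p1 ++ p2) = voltage x p1 * voltage (last x p1) p2.
Proof. by elim: p1 x => [|y p IHp] x /=; rewrite ?mul1g// IHp mulgA. Qed.

Lemma voltage_rcons x p y :
  voltage x (rcons p y) = voltage x p * phi (last x p) y.
Proof. by rewrite -cats1 voltage_cat /= mulg1. Qed.

(** The case of a single edge traversed back and forth is included, as a simple
    cycle with two vertices. *)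
Definition flat k := (forall x, phi x x = 1) /\
  (forall x c, ucycle (@adj G) (x :: c) -> (size c < k)%N ->
     voltage x (rcons c x) = 1).

Lemma path_eq_adj_uniq x p : path (@eq_adj G) x p -> uniq (x :: p) ->
  path (@adj G) x p.
Proof.
elim: p x => //= y p IHp x /andP[/orP[/eqP->|xy] yp] /and3P[].
  by rewrite mem_head.
by move=> _ y_p up; rewrite xy IHp//= y_p.
Qed.

Lemma path_adj_eq x p : path (@adj G) x p -> path (@eq_adj G) x p.
Proof. by apply: sub_path => a b ab; rewrite /eq_adj ab orbT. Qed.

Lemma repeated_vertex_split x p : ~~ uniq (x :: p) ->
  exists p1 p2 p3, [/\ p = p1 ++ p2 ++ p3, (0 < size p2)%N
    & last (last x p1) p2 = last x p1].
Proof.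
elim: p x => [//|y p IHp] x; rewrite cons_uniq negb_and negbK.
have [xp _|_ /= /IHp[p1 [p2 [p3 [-> p20 p2E]]]]] := boolP (x \in y :: p).
  case/splitPr: xp => p1 p2; exists [::], (rcons p1 x), p2.
  by rewrite size_rcons last_rcons cat_rcons.
by exists (y :: p1), p2, p3.
Qed.

(** A closed walk that is not a simple cycle repeats a vertex, hence contains a
    shorter closed walk whose removal leaves a shorter closed walk; both have
    trivial voltage by induction on the length. *)
Lemma flat_closed_walk k x p : flat k -> path (@eq_adj G) x p ->
  last x p = x -> (size p <= k)%N -> voltage x p = 1.
Proof.
move=> [phi1 phik]; have [n] := ubnP (size p).
elim: n x p => // n IHn x p pn xp px pk.
case/lastP: p => [//|c z] in pn xp px pk *.
rewrite last_rcons in px; rewrite {z}px in pn xp pk *.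
rewrite size_rcons ltnS in pn; rewrite size_rcons in pk.
have [c_uniq|/repeated_vertex_split[p1 [p2 [p3 [cE p20 p2E]]]]] :=
  boolP (uniq (x :: c)).
  case: c => [|y c] in pn xp pk c_uniq *; first by rewrite /= phi1 mulg1.
  apply: phik => //; apply/andP; split=> //.
  move: xp; rewrite /= !rcons_path => /and3P[xy yc cx].
  have /= /andP[-> ->] : path (@adj G) x (y :: c).
    by apply: path_eq_adj_uniq => //=; rewrite xy.
  case/orP: cx => //= /eqP cx.
  by move: c_uniq; rewrite /= -[in X in X && _]cx mem_last.
have pE : rcons c x = p1 ++ p2 ++ rcons p3 x by rewrite cE !rcons_cat.
move: xp; rewrite pE !cat_path p2E => /and3P[xp1 xp2 xp3].
have cs : size c = (size p1 + size p2 + size p3)%N.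
  by rewrite cE !size_cat addnA.
rewrite !voltage_cat p2E (IHn _ p2)//; last 2 first.
- by lia.
- by lia.
rewrite mul1g -voltage_cat; apply: IHn.
- by rewrite size_cat size_rcons; lia.
- by rewrite cat_path xp1.
- by rewrite last_cat last_rcons.
- by rewrite size_cat size_rcons; lia.
Qed.

Lemma flat_inv k x y : flat k -> (1 < k)%N -> eq_adj x y ->
  phi y x = (phi x y)^-1.
Proof.
move=> phi_flat k1 xy; symmetry; apply: mulg1_eq.
have := @flat_closed_walk k x [:: y; x] phi_flat.
by rewrite /= mulg1 xy eq_adj_sym xy => ->.
Qed.

(** If the voltage around a cycle is trivial, then it is on the edges of the
    cycle the difference of a potential, namely the voltage accumulated from
    the starting vertex. So it is trivial along any closed walk on these edges,
    whatever the starting vertex and the orientation. *)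
Section CycleEdges.
Variables (x0 : G) (s : seq G).
Hypothesis phiV : forall x y, adj x y -> phi y x = (phi x y)^-1.
Hypothesis s_cycle : ucycle (@adj G) (x0 :: s).
Hypothesis s_null : voltage x0 (rcons s x0) = 1.

Definition potential x := voltage x0 (take (index x (x0 :: s)) s).

Lemma potential_next x : x \in x0 :: s ->
  potential (next (x0 :: s) x) = potential x * phi x (next (x0 :: s) x).
Proof.
move=> xs; have [_ s_uniq] := andP s_cycle.
have := nth_index x0 xs; rewrite next_nth xs /potential.
have := xs; rewrite -index_mem; set i := index x _.
rewrite [size _]/= ltnS => is_ iE.
have xE : last x0 (take i s) = x.
  rewrite -iE; case: (i) is_ => [|j] js; rewrite ?take0//.
  by rewrite (take_nth x0 js) last_rcons.
move: is_; rewrite leq_eqVlt => /predU1P[i_s|i_s].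
  rewrite nth_default ?i_s// -xE /= eqxx.
  by rewrite i_s take_size take0 -voltage_rcons s_null.
have -> : index (nth x0 s i) (x0 :: s) = i.+1.
  by rewrite -[nth x0 s i]/(nth x0 (x0 :: s) i.+1) index_uniq.
by rewrite (take_nth x0)// voltage_rcons xE.
Qed.

Lemma potential_edge a b : [set a; b]%SET \in cycle_edges (x0 :: s) ->
  phi a b = (potential a)^-1 * potential b.
Proof.
have [s_adj _] := andP s_cycle.
case/finset.imsetP => x xs abE.
have := potential_next xs; have := next_cycle s_adj xs.
move: (next _ x) abE => y abE xy yE.
have xyE : phi x y = (potential x)^-1 * potential y by rewrite yE mulKg.
have xNy : x != y by apply: contraTneq xy => ->; rewrite adj_irrefl.
have : x \in [set a; b]%SET by rewrite abE set21.
have : y \in [set a; b]%SET by rewrite abE set22.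
case/set2P=> ya /set2P[] xa; move: xNy; rewrite ya xa ?eqxx// => _.
  by rewrite -xa -ya (phiV xy) xyE invgM invgK.
by rewrite -xa -ya.
Qed.

Lemma voltage_same_cycle y c : ucycle (@adj G) (y :: c) ->
  cycle_edges (y :: c) = cycle_edges (x0 :: s) -> voltage y (rcons c y) = 1.
Proof.
move=> /andP[_ c_uniq] csE.
pose e a b := phi a b == (potential a)^-1 * potential b.
have tele a p : path e a p ->
    voltage a p = (potential a)^-1 * potential (last a p).
  elim: p a => [|b p IHp] a /=; first by rewrite mulVg.
  by move=> /andP[/eqP-> /IHp->]; rewrite mulgA mulgK.
rewrite tele ?last_rcons ?mulVg//.
have := cycle_next c_uniq; apply: sub_in_cycle (allss (y :: c)).
move=> a b /= ac _ /eqP <-; apply/eqP/potential_edge; rewrite -csE.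
by apply/finset.imsetP; exists a.
Qed.
End CycleEdges.

(** * The height function on the cover

    The pair (g, v) stands for the vertex of the cover reached from the base
    vertex by the walks of voltage g that end in v, and its height is the
    length of a shortest such walk. *)
Section Cover.
Hypothesis phi_flat : flat 5.
Hypothesis G_conn : is_connected G.
Variable o : G.

Lemma remove_stays x p : path (@eq_adj G) x p ->
  exists p', [/\ path (@adj G) x p', last x p' = last x p
               & voltage x p' = voltage x p].
Proof.
have [phi1 _] := phi_flat.
elim: p x => [|y p IHp] x /=; first by exists [::].
case/andP=> /orP[/eqP<-|xy] /IHp[p' [p'p p'l p'v]].
  by exists p'; rewrite phi1 mul1g.
by exists (y :: p'); rewrite /= xy p'v.
Qed.

Definition reached g v n := `[< exists p, [/\ path (@adj G) o p, last o p = v,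
  voltage o p = g & size p = n] >].

Hypothesis all_reached : forall g v, exists n, reached g v n.

Definition height g v : nat := ex_minn (all_reached g v).

Lemma height_walk g v : exists p, [/\ path (@adj G) o p, last o p = v,
  voltage o p = g & size p = height g v].
Proof. by rewrite /height; case: ex_minnP => m /asboolP. Qed.

Lemma height_min p : path (@adj G) o p ->
  (height (voltage o p) (last o p) <= size p)%N.
Proof.
move=> op; rewrite /height; case: ex_minnP => m _; apply.
by apply/asboolP; exists p.
Qed.

Lemma height_step g v w : eq_adj v w ->
  (height (g * phi v w) w <= (height g v).+1)%N.
Proof.
have [phi1 _] := phi_flat.
case/orP=> [/eqP<-|vw]; first by rewrite phi1 mulg1 leqW.
have [p [op pv <- <-]] := height_walk g v; rewrite -pv in vw *.
rewrite -voltage_rcons -(size_rcons p w) -{2}(last_rcons o p w).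
by apply: height_min; rewrite rcons_path op.
Qed.

Lemma height_adj g v w : adj v w ->
  (height g v <= (height (g * phi v w) w).+1)%N.
Proof.
move=> vw; have vw' : eq_adj v w by rewrite /eq_adj vw orbT.
have := height_step (g * phi v w) (etrans (eq_adj_sym w v) vw').
by rewrite (flat_inv phi_flat isT vw') mulgK.
Qed.

Lemma height_path g v p : path (@eq_adj G) v p ->
  (height (g * voltage v p) (last v p) <= height g v + size p)%N.
Proof.
elim: p g v => [|w p IHp] g v /=; first by rewrite mulg1 addn0.
move=> /andP[vw /(IHp (g * phi v w))]; rewrite -mulgA => /leq_trans; apply.
by rewrite addnS -addSn leq_add2r height_step.
Qed.

Lemma height_pred g v n : height g v = n.+1 ->
  exists h w, [/\ adj w v, g = h * phi w v & height h w = n].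
Proof.
move=> gvn; have [p [op pv pg ps]] := height_walk g v; rewrite gvn in ps.
case/lastP: p op pv pg ps => [//|p z]; rewrite rcons_path last_rcons size_rcons.
move=> /andP[op pz] zv; rewrite {z}zv in pz *; rewrite voltage_rcons => pg [pn].
have pz' : eq_adj (last o p) v by rewrite /eq_adj pz orbT.
exists (voltage o p), (last o p); split=> //.
apply/eqP; rewrite eqn_leq -{1}pn height_min//= -ltnS -gvn -pg.
exact: height_step.
Qed.

(** The unit balls around the two ends of a lifted edge are no farther apart in
    the cover than in the graph: a shortest walk of length at most 2 from u to v
    is part of a closed walk of length at most 5 through x and y, so that it
    lifts to a walk between the prescribed lifts of u and v. When the distance
    is 3, the walk through x and y does. *)
Lemma height_lipschitz g x y u v : adj x y -> eq_adj x u -> eq_adj y v ->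
  (height (g * phi x y * phi y v) v <= height (g * phi x u) u + dist u v)%N.
Proof.
move=> xy xu yv; have xy' : eq_adj x y by rewrite /eq_adj xy orbT.
have [p [up pl ps]] := dist_walk u v G_conn; have up' := path_adj_eq up.
have [d3|d3] := leqP 3 (dist u v).
  apply: leq_trans (leq_add (leqnn _) d3).
  have := @height_path (g * phi x u) u [:: x; y; v].
  rewrite /= eq_adj_sym xu xy' yv mulg1 (flat_inv phi_flat isT xu) !mulgA mulgK.
  by apply.
have : voltage x (u :: p ++ [:: y; x]) = 1.
  apply: (flat_closed_walk phi_flat).
  - by rewrite /= xu cat_path up' pl /= eq_adj_sym yv eq_adj_sym xy'.
  - by rewrite /= last_cat.
  - by rewrite /= size_cat ps /=; lia.
rewrite /= voltage_cat pl /= mulg1 (flat_inv phi_flat isT yv).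
rewrite (flat_inv phi_flat isT xy') -invgM mulgA.
move=> /divg1_eq volE.
by have := height_path (g * phi x u) up'; rewrite -!mulgA volE pl ps.
Qed.

(** * Bonnet-Myers on the cover *)

Section Diameter.
Variable R : realType.
Local Open Scope ring_scope.

(** The height function in the lift of the unit ball of x that is centred at
    (g, x); values outside this ball have no meaning. *)
Definition lift g x : G -> R := fun u => (height (g * phi x u)%g u)%:R.

Lemma lift_base g x : lift g x x = (height g x)%:R.
Proof. by have [phi1 _] := phi_flat; rewrite /lift phi1 mulg1. Qed.

Lemma laplacian_lift_norm g x : `|laplacian (lift g x) x| <= 1.
Proof.
have lip u : adj x u -> `|lift g x u - lift g x x| <= 1.
  move=> xu; have xu' : eq_adj x u by rewrite /eq_adj xu orbT.
  have := height_step g xu'; have := height_adj g xu.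
  rewrite -!(ler_nat R) -!natr1 lift_base /lift ler_norml => ? ?.
  by apply/andP; split; lra.
rewrite /laplacian normrM normfV [X in _ / X]ger0_norm//.
have [->|d0] := eqVneq (deg x) 0%N; first by rewrite invr0 mulr0.
rewrite ler_pdivrMr ?ltr0n ?lt0n// mul1r.
apply: le_trans (ler_norm_sum _ _ _) _.
by apply: le_trans (ler_sum _ lip) _; rewrite sumr_const.
Qed.

Variable k : R.
Hypothesis k_gt0 : 0 < k.
Hypothesis k_le : forall x y, adj x y -> k <= kappa R x y.

(** Induction along a geodesic to the base vertex: by [laplacian_drop] every
    step outwards costs k. *)
Lemma laplacian_lift_height g v :
  laplacian (lift g v) v <= 1 - (height g v)%:R * k.
Proof.
move: {2}(height g v) (leqnn (height g v)) => n.
elim: n g v => [|n IHn] g v.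
  rewrite leqn0 => /eqP ->; rewrite mul0r subr0.
  exact: le_trans (ler_norm _) (laplacian_lift_norm g v).
rewrite leq_eqVlt => /orP[/eqP gvn|/IHn//].
have [h [w [wv gE hn]]] := height_pred gvn.
have /= := @laplacian_drop R G w v (lift h w) (lift g v) G_conn wv
  (lt_le_trans k_gt0 (k_le wv)).
have lipvw u z : eq_adj w u -> eq_adj v z ->
    lift g v z - lift h w u <= (dist u z)%:R.
  move=> wu vz; rewrite lerBlDl -natrD ler_nat gE.
  exact: height_lipschitz.
move=> /(_ lipvw); rewrite !lift_base gvn hn -natr1 addrC addKr => /(_ erefl).
have := IHn h w; rewrite hn leqnn => /(_ isT); have := k_le wv.
by lra.
Qed.

Lemma height_le g v : (height g v <= Num.truncn (2 / k))%N.
Proof.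
rewrite truncn_ge_nat ?divr_ge0 ?(ltW k_gt0)// ler_pdivlMr//.
have := laplacian_lift_height g v.
by have := laplacian_lift_norm g v; rewrite ler_norml => /andP[]; lra.
Qed.

End Diameter.

(** * Counting the vertices of the cover *)

(** The non-backtracking walks of length n from y which may continue the edge
    from x to y, as lists without the starting vertex y. *)
Fixpoint reduced_walks n x y : seq (seq G) :=
  if n is n'.+1 then
    [seq z :: p | z <- enum [pred z | adj y z & z != x],
                  p <- reduced_walks n' y z]
  else [:: [::]].

Lemma deg_le x : (deg x <= max_deg G)%N.
Proof. exact: leq_bigmax. Qed.

Lemma leq_sumn (s : seq nat) m : all (leq^~ m) s -> (sumn s <= size s * m)%N.
Proof.
by elim: s => //= n s IHs /andP[nm /IHs]; rewrite mulSn; apply: leq_add.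
Qed.

Lemma size_reduced_walks n x y : adj x y ->
  (size (reduced_walks n x y) <= (max_deg G).-1 ^ n)%N.
Proof.
elim: n x y => // n IHn x y xy /=; rewrite size_allpairs_dep expnS.
have yx : adj y x by rewrite adj_sym.
apply: leq_trans (@leq_sumn _ ((max_deg G).-1 ^ n)%N _) _.
  apply/allP => _ /mapP[z /[!mem_enum] /andP[/= yz _] ->]; exact: IHn.
rewrite size_map -cardE leq_mul2r; apply/orP; right.
rewrite -ltnS prednK; last by apply: leq_trans (deg_le y); exact: deg_gt0 yx.
apply: leq_trans (deg_le y); apply/proper_card/properP; split.
  by apply/fintype.subsetP => z; rewrite !inE => /andP[].
by exists x; rewrite !inE ?yx ?eqxx.
Qed.

Definition reduced_walks_upto r : seq (seq G) := [::] ::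
  flatten [seq [seq z :: p | z <- enum [pred z | adj o z],
                             p <- reduced_walks n o z] | n <- iota 0 r].

Lemma size_reduced_walks_upto r : (size (reduced_walks_upto r) <=
  1 + max_deg G * \sum_(n < r) (max_deg G).-1 ^ n)%N.
Proof.
rewrite /= add1n ltnS size_flatten /shape -map_comp sumnE big_map.
rewrite -[r in iota _ r]subn0 -/(index_iota 0 r) big_mkord big_distrr /=.
apply: leq_sum => n _; rewrite /= size_allpairs_dep.
apply: leq_trans (@leq_sumn _ ((max_deg G).-1 ^ n)%N _) _.
  apply/allP => _ /mapP[z /[!mem_enum] /= oz ->]; exact: size_reduced_walks.
by rewrite size_map -cardE leq_mul2r deg_le orbT.
Qed.

Definition shortest x p := path (@adj G) x p /\
  forall q, path (@adj G) x q -> last x q = last x p ->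
    voltage x q = voltage x p -> (size p <= size q)%N.

Lemma shortest_behead x y p : shortest x (y :: p) -> shortest y p.
Proof.
move=> [/= /andP[xy yp] xmin]; split=> // q yq yl yv.
by have := xmin (y :: q); rewrite /= xy yq yl yv; apply.
Qed.

(** Cutting out a step and its reversal changes neither the voltage nor the
    last vertex, so a shortest walk does not backtrack. *)
Lemma shortest_reduced x y p : shortest x (y :: p) ->
  p \in reduced_walks (size p) x y.
Proof.
elim: p x y => [|z p IHp] x y; first by rewrite inE.
move=> xmin; have ymin := shortest_behead xmin.
case: xmin => /= /and3P[xy yz zp] xmin.
apply/allpairsPdep; exists z, p; split=> //; last exact: IHp.
rewrite mem_enum inE yz; apply/eqP => zx; subst z.
have xy' : eq_adj x y by rewrite /eq_adj xy orbT.
have /= := xmin p zp erefl.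
by rewrite (flat_inv phi_flat isT xy') mulVKg => /(_ erefl); lia.
Qed.

Lemma cover_card (s : seq Q) r : uniq s -> (forall g v, (height g v <= r)%N) ->
  (size s * #|G| <= 1 + max_deg G * \sum_(n < r) (max_deg G).-1 ^ n)%N.
Proof.
move=> s_uniq height_r.
apply: leq_trans (size_reduced_walks_upto r).
rewrite cardE -(size_allpairs pair).
rewrite -(size_map (fun p => (voltage o p, last o p))).
apply: uniq_leq_size.
  by apply: allpairs_uniq => //; [exact: enum_uniq|move=> [? ?] [? ?]].
move=> _ /allpairsP[[g v] [_ _ ->]]; apply/mapP.
have [p [op pv pg ps]] := height_walk g v; exists p; last by rewrite pg pv.
have omin : shortest o p.
  split=> // q oq ql qv; rewrite ps -pv -pg -ql -qv; exact: height_min.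
case: p => [|y p] in op pv pg ps omin *; first exact: mem_head.
rewrite inE; apply/orP; right; apply/flatten_mapP; exists (size p).
  by rewrite mem_iota /= add0n; have := height_r g v; rewrite -ps.
apply/allpairsPdep; exists y, p; split=> //.
  by move: op => /= /andP[oy _]; rewrite mem_enum.
exact: shortest_reduced.
Qed.

End Cover.

End Voltage.

(** * The voltage with values in a quotient of the fundamental group *)

Section FundamentalGroup.
Variables (G : sgraph) (o : G) (N : normal_subgroup (glmy_pi1 o)).
Implicit Types (x y : G) (p c s : seq G).
Local Open Scope group_scope.
Local Notation Q := (quotient_group N).

Definition closed_at x s := path (@eq_adj G) x s && (last x s == x).

(** Total on sequences, with the default value 1 outside closed walks, so that
    concatenations need not carry proofs that they are loops. *)
Definition walk_class s : Q :=
  if insub s is Some l then quot_pi N (@loop_class G o l) else 1.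

Lemma walk_class_loop (l : loop o) : walk_class l = quot_pi N (loop_class l).
Proof. by rewrite /walk_class valK. Qed.

Lemma walk_class_cat s s' : closed_at o s -> closed_at o s' ->
  walk_class (s ++ s') = walk_class s * walk_class s'.
Proof.
move=> sP s'P; have /= := walk_class_loop (loop_cat (Loop sP) (Loop s'P)) => ->.
have /= -> := walk_class_loop (Loop sP).
have /= -> := walk_class_loop (Loop s'P).
by rewrite -loop_classM -quot_piM.
Qed.

Lemma rev_belastK x p : rev (belast (last x p) (rev (belast x p))) = p.
Proof.
case/lastP: p => [//|p z]; rewrite belast_rcons last_rcons rev_cons.
by rewrite belast_rcons rev_cons revK.
Qed.

(** The local moves rewrite a walk in context, so a homotopy of loops based at x
    acts inside any closed walk at o that passes through x. *)
Lemma walk_class_splice x a b (l l' : loop x) :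
  path (@eq_adj G) o a -> last o a = x -> path (@eq_adj G) x b ->
  last x b = o -> loop_equiv l l' ->
  walk_class (a ++ l ++ b) = walk_class (a ++ l' ++ b).
Proof.
move=> oa ax xb bo.
have cl (m : loop x) : closed_at o (a ++ m ++ b).
  have /andP[mp /eqP ml] := loopP m.
  by rewrite /closed_at !cat_path !last_cat ax ml bo oa mp xb eqxx.
have aE r : o :: a ++ r = belast o a ++ x :: r.
  by rewrite -cat_cons lastI cat_rcons ax.
elim=> {l l'} [l l' [u [v [s [s' [ss' lE l'E]]]]]|//|//|l1 l2 l3 _ + _].
  have /= -> := walk_class_loop (Loop (cl l)).
  have /= -> := walk_class_loop (Loop (cl l')).
  congr quot_pi; apply/loop_classP/rst_step.
  exists (belast o a ++ u), (v ++ b), s, s'; split=> //=.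
    by rewrite aE -cat_cons lE -!catA.
  by rewrite aE -cat_cons l'E -!catA.
exact: etrans.
Qed.

Section Rooted.
Variable root_path : G -> seq G.
Hypothesis root_pathP : forall x,
  path (@eq_adj G) o (root_path x) /\ last o (root_path x) = x.

Definition return_path x := rev (belast o (root_path x)).

Lemma return_pathP x :
  path (@eq_adj G) x (return_path x) /\ last x (return_path x) = o.
Proof.
have [rp rl] := root_pathP x; rewrite /return_path -{1 3}rl.
by rewrite path_rev_belast last_rev_belast.
Qed.

Lemma walk_class_round_trip x : walk_class (root_path x ++ return_path x) = 1.
Proof.
have [rp rl] := root_pathP x; have [bp bl] := return_pathP x.
have lP : closed_at o (root_path x ++ return_path x).
  by rewrite /closed_at cat_path last_cat rl rp bp bl eqxx.
have /= -> := walk_class_loop (Loop lP).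
have /loop_classP -> := palindrome_equiv rp (l := Loop lP) erefl.
by [].
Qed.

Lemma walk_class_null x (l : loop x) : loop_equiv l (loop_nil x) ->
  walk_class (root_path x ++ l ++ return_path x) = 1.
Proof.
have [rp rl] := root_pathP x; have [bp bl] := return_pathP x.
move=> l0; rewrite (walk_class_splice rp rl bp bl l0) /=.
exact: walk_class_round_trip.
Qed.

Definition edge_class x y : Q := walk_class (root_path x ++ y :: return_path y).

(** Voltages telescope: between two consecutive edges, the path back to the
    base vertex cancels against the path leaving it. *)
Lemma voltage_edge_class x p : path (@eq_adj G) x p ->
  voltage edge_class x p =
  walk_class (root_path x ++ p ++ return_path (last x p)).
Proof.
elim: p x => [|y p IHp] x /=; first by rewrite walk_class_round_trip.
case/andP=> xy yp; rewrite (IHp _ yp) /edge_class.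
have [rpx rlx] := root_pathP x; have [rpy rly] := root_pathP y.
have [bpy bly] := return_pathP y; have [bpz blz] := return_pathP (last y p).
rewrite -walk_class_cat; last 2 first.
- by rewrite /closed_at cat_path last_cat /= rlx rpx xy bpy bly eqxx.
- by rewrite /closed_at !cat_path !last_cat rly rpy yp bpz blz eqxx.
have lP : closed_at y (return_path y ++ root_path y).
  by rewrite /closed_at cat_path last_cat bly bpy rpy rly eqxx.
have l0 : loop_equiv (Loop lP) (loop_nil y).
  apply: (palindrome_equiv bpy) => /=; congr (_ ++ _).
  by have := rev_belastK o (root_path y); rewrite rly.
have /= := walk_class_splice (a := rcons (root_path x) y)
  (b := p ++ return_path (last y p)) _ _ _ _ l0.
rewrite cat_rcons -!catA => -> //; first by rewrite cat_rcons.
- by rewrite rcons_path rpx rlx.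
- by rewrite last_rcons.
- by rewrite cat_path yp.
- by rewrite last_cat.
Qed.

Lemma backtrack_null x y (l : loop x) : adj x y -> loop_tail l = [:: y; x] ->
  loop_equiv l (loop_nil x).
Proof.
move=> xy lE; apply: rst_step; exists [::], [::], [:: x; y; x], [:: x].
by split=> //; [exact: LM_back|rewrite lE].
Qed.

Lemma short_cycle_null x c (l : loop x) : ucycle (@adj G) (x :: c) ->
  (size c < 4)%N -> loop_tail l = rcons c x -> loop_equiv l (loop_nil x).
Proof.
have backP y : adj x y -> closed_at x [:: y; x].
  by move=> xy; rewrite /closed_at /= /eq_adj [adj y x]adj_sym xy !orbT eqxx.
case: c => [|y [|z [|w [|//]]]] xc _ lE.
- by move: xc; rewrite /ucycle /= adj_irrefl.
- by apply: backtrack_null lE; case/andP: xc => /andP[].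
- have xz : adj x z by move: xc => /andP[/= /and4P[_ _ + _] _]; rewrite adj_sym.
  apply: rst_trans (backtrack_null (l := Loop (backP z xz)) xz erefl).
  apply: rst_step; exists [::], [:: x], [:: x; y; z], [:: x; z].
  by split=> //; [exact: LM_tri|rewrite lE].
- have xw : adj x w.
    by move: xc => /andP[/= /and5P[_ _ _ + _] _]; rewrite adj_sym.
  apply: rst_trans (backtrack_null (l := Loop (backP w xw)) xw erefl).
  apply: rst_step; exists [::], [:: x], [:: x; y; z; w], [:: x; w].
  by split=> //; [exact: LM_square3|rewrite lE].
Qed.

Lemma ucycle_walk x c :
  ucycle (@adj G) (x :: c) -> path (@eq_adj G) x (rcons c x).
Proof. by case/andP=> xc _; apply: path_adj_eq. Qed.

Lemma edge_class_flat4 : flat edge_class 4.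
Proof.
split=> [x|x c xc c4].
  have lP : closed_at x [:: x] by rewrite /closed_at /= /eq_adj eqxx.
  have := @walk_class_null x (Loop lP); apply.
  apply: rst_step; exists [::], [::], [:: x; x], [:: x].
  by split=> //; exact: LM_stay.
have xcp := ucycle_walk xc.
have lP : closed_at x (rcons c x) by rewrite /closed_at xcp last_rcons eqxx.
rewrite voltage_edge_class// last_rcons.
exact: (walk_class_null (short_cycle_null xc c4 (l := Loop lP) erefl)).
Qed.

(** The cover is connected: an element of the quotient is the class of a loop
    at o, and the connecting path to v contributes nothing to the voltage. *)
Lemma edge_class_reached g v : root_path o = [::] ->
  exists p, [/\ path (@eq_adj G) o p, last o p = v
              & voltage edge_class o p = g].
Proof.
move=> ro; have [rp rl] := root_pathP v; have [bp bl] := return_pathP v.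
set l := pi1_repr (quot_repr g); have /andP[lp /eqP ll] := loopP l.
have lv : path (@eq_adj G) o (l ++ root_path v) by rewrite cat_path lp ll.
exists (l ++ root_path v); rewrite last_cat ll; split=> //.
rewrite voltage_edge_class// ro last_cat ll rl /= -catA walk_class_cat.
- by rewrite walk_class_round_trip mulg1 walk_class_loop pi1_reprK quot_reprK.
- exact: loopP.
- by rewrite /closed_at cat_path last_cat rl rp bp bl eqxx.
Qed.

End Rooted.
End FundamentalGroup.

(** * Killing the 5-cycles *)

Section FiveCycles.
Variables (G : sgraph) (o : G) (t : rel G) (S : {set 5.-tuple G}).
Hypotheses (t_tree : spanning_tree t) (S_marked : marked_5cycles S).
Local Open Scope group_scope.

Lemma tree_paths : exists root_path : G -> seq G,
  forall x, path t o (root_path x) && uniq (o :: root_path x) /\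
            last o (root_path x) = x.
Proof.
case: t_tree => _ _ t_conn _.
have ex x : exists p, path t o p && uniq (o :: p) /\ last o p = x.
  have /connectP[p tp ->] := t_conn o x.
  by case: (shortenP tp) => p' tp' up' _; exists p'; rewrite tp' up'.
by have [root_path rootP] := choice ex; exists root_path.
Qed.

Variable root_path : G -> seq G.
Hypothesis root_pathP : forall x,
  path t o (root_path x) && uniq (o :: root_path x) /\ last o (root_path x) = x.

Lemma tree_root_path x :
  path (@eq_adj G) o (root_path x) /\ last o (root_path x) = x.
Proof.
have [_ t_adj _ _] := t_tree; have [/andP[tp _] rl] := root_pathP x.
by split=> //; apply/path_adj_eq/(sub_path t_adj).
Qed.

Lemma tree_root_path_nil : root_path o = [::].
Proof.
have [/andP[_ /= /andP[oNp _]] ol] := root_pathP o.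
by case: (root_path o) ol oNp => //= y p <-; rewrite mem_last.
Qed.

(** The subgroup contains the loop around the marked traversal of each 5-cycle;
    the other traversals of the same cycle follow by [voltage_same_cycle]. *)
Lemma edge_class_flat5 : flat (@edge_class G o (N5 o t S) root_path) 5.
Proof.
have flat4 := edge_class_flat4 (N5 o t S) tree_root_path.
have [stay short] := flat4; split=> // y c yc.
rewrite ltnS leq_eqVlt => /predU1P[c4|]; last exact: short.
have [S_cycle S_all] := S_marked.
have yc5 : size (y :: c) == 5 by rewrite /= c4.
have [s [[sS sE] _]] := S_all (Tuple yc5) yc.
have s_cycle := S_cycle _ sS.
case def_s : (tval s) => [|x s'] in s_cycle sE.
  by have := size_tuple s; rewrite def_s.
apply: (voltage_same_cycle _ s_cycle _ yc (esym sE)) => [a b ab|].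
  by apply: flat_inv flat4 _ _ => //; rewrite /eq_adj ab orbT.
have xs := ucycle_walk s_cycle.
rewrite (voltage_edge_class _ tree_root_path)// last_rcons.
have [rp rl] := tree_root_path x; have [bp bl] := return_pathP tree_root_path x.
have lP : closed_at o (root_path x ++ rcons s' x ++ return_path o root_path x).
  by rewrite /closed_at !cat_path !last_cat last_rcons rl rp xs bp bl eqxx.
have /= -> := walk_class_loop (N5 o t S) (Loop lP).
apply/esym/quot_piP; rewrite invg1 mul1g => M [_]; apply.
exists (Loop lP) => //; exists s, (root_path x), x, s'; split=> //.
  by case: (root_pathP x).
Qed.

End FiveCycles.

(** * The bound *)

Local Open Scope ring_scope.

Theorem corollary4p7 (R : realType) (G : sgraph)
  (G_conn : is_connected G)
  (G_edge : exists x y : G, adj x y)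
  (kappa_gt0 : 0 < kappa_min R G)
  (o : G) (t : rel G) (S : {set 5.-tuple G})
  (t_tree : spanning_tree t)
  (S_marked : marked_5cycles S) :
  let n := #|G| in
  let Delta : R := (max_deg G)%:R in
  let r := Num.truncn (2 / kappa_min R G) in
  let Q := quotient_group (N5 o t S) in
  finite_set [set: Q]%classic /\
  (#|` fset_set [set: Q]%classic |)%fset%:R <=
    (1 + Delta * \sum_(j < r) (Delta - 1) ^+ j) / n%:R.
Proof.
move=> n Delta r Q.
have [root_path root_pathP] := tree_paths o t_tree.
have phi_flat := edge_class_flat5 t_tree S_marked root_pathP.
set phi := edge_class _ _ in phi_flat.
have reach g v : exists n, reached phi o g v n.
  have [p [op pv pg]] :=
    edge_class_reached (tree_root_path t_tree root_pathP) g v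
      (tree_root_path_nil root_pathP).
  have [q [oq qp qv]] := remove_stays phi_flat op.
  by exists (size q); apply/asboolP; exists q; rewrite qp qv.
have height_r := height_le phi_flat G_conn reach kappa_gt0 (@kappa_min_le R G).
have card_bound (s : seq Q) : uniq s -> (size s * #|G| <=
    1 + max_deg G * \sum_(j < r) (max_deg G).-1 ^ j)%N.
  by move=> s_uniq; exact: (cover_card phi_flat s_uniq height_r).
have Delta1 : Delta - 1 = (max_deg G).-1%:R.
  have [x [y xy]] := G_edge.
  have : (0 < max_deg G)%N by apply: leq_trans (deg_gt0 xy) (deg_le x).
  by rewrite /Delta; case: (max_deg G) => // m _; rewrite -natr1 addrK.
have n0 : (0 < n)%N by apply/card_gt0P; exists o.
have Q_fin : finite_set [set: Q]%classic.
  apply: contrapT => /infinite_set_fset.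
  move=> /(_ (1 + max_deg G * \sum_(j < r) (max_deg G).-1 ^ j).+1%N)[B _].
  move=> leB; have := leq_trans leB (leq_pmulr _ n0).
  by rewrite ltnNge card_bound ?fset_uniq.
split=> //; rewrite ler_pdivlMr ?ltr0n// -natrM.
apply: (@le_trans _ _
  (1 + max_deg G * \sum_(j < r) (max_deg G).-1 ^ j)%N%:R).
  by rewrite ler_nat; apply: card_bound; exact: fset_uniq.
rewrite Delta1 natrD natrM natr_sum lerD2l ler_wpM2l//.
by apply: ler_sum => j _; rewrite natrX.
Qed.
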